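(* Let $R$ be a ring with identity and let $a,w,b,c,s,t\in R$ be such that the $(t,c)$-inverse $a^{(t,c)}$ of $a$ and the $(b,s)$-inverse $(a^{(t,c)}aw)^{(b,s)}$ of $a^{(t,c)}aw$ exist. Then the following statements are equivalent: (i) $aw$ is $(b,c)$-invertible and $(aw)^{(b,c)}=(a^{(t,c)}aw)^{(b,s)}a^{(t,c)}$; (ii) $c=caw(a^{(t,c)}aw)^{(b,s)}a^{(t,c)}$.
   Context: Rings are associative with identity, not necessarily commutative. For $b,c\in R$, an element $a\in R$ is called $(b,c)$-invertible if there exists $y\in R$ such that $y\in (bRy)\cap (yRc)$, $yab=b$ and $cay=c$. Such a $y$ is unique when it exists; it is called the $(b,c)$-inverse of $a$ and denoted $a^{(b,c)}$. *)

(* Defs.v *)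
From mathcomp Require Import all_boot all_algebra.
From mathcomp Require Import boolp classical_sets.

Set Implicit Arguments.
Unset Strict Implicit.
Unset Printing Implicit Defensive.

Import GRing.Theory.
Local Open Scope ring_scope.

(* The first two conjuncts say that y lies in b R y and in y R c. *)
Definition is_bc_inverse (R : pzRingType) (b c a y : R) : Prop :=
  [/\ exists r : R, y = b * r * y,
      exists r : R, y = y * r * c,
      y * a * b = b
    & c * a * y = c].

Definition bc_invertible (R : pzRingType) (b c a : R) : Prop :=
  exists y : R, is_bc_inverse b c a y.

(* Total version of a^(b,c): the (b,c)-inverse of a when a is
   (b,c)-invertible, and the junk value 0 otherwise. *)
Definition bc_inverse (R : pzRingType) (b c a : R) : R :=
  xget 0 (is_bc_inverse b c a).

Lemma is_bc_inverse_unique (R : pzRingType) (b c a y z : R) :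
  is_bc_inverse b c a y -> is_bc_inverse b c a z -> y = z.
Proof.
move=> [_ [r yE] yab _] [[q zE] _ _ caz].
have y1 : y = y * a * z by rewrite [LHS]yE -caz !mulrA -yE.
have z1 : z = y * a * z.
  by rewrite [LHS]zE -[in LHS]yab -!mulrA [b * (q * z)]mulrA -zE.
by rewrite [LHS]y1 -z1.
Qed.

Lemma bc_inverseP (R : pzRingType) (b c a : R) :
  bc_invertible b c a -> is_bc_inverse b c a (bc_inverse b c a).
Proof. by case=> y yP; exact: xgetPex (ex_intro _ y yP). Qed.

Lemma bc_inverse_eq (R : pzRingType) (b c a y : R) :
  is_bc_inverse b c a y -> bc_inverse b c a = y.
Proof.
move=> yP; apply: (is_bc_inverse_unique _ yP).
by apply: bc_inverseP; exists y.
Qed.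

(* Main.v *)
Require Import Defs.
From mathcomp Require Import all_boot all_algebra.

Import GRing.Theory.
Local Open Scope ring_scope.

(** Let [x] be the inner inverse and [y] the outer one. The product [y * x] inherits membership in
    [b R (y x)] and the identity [y x (a w) b = b] from [y], and membership in [(y x) R c] from [x].
    The one remaining axiom, [c (a w) (y x) = c], is exactly (ii). Uniqueness of the inverse then
    turns this into a statement about [bc_inverse]. *)

Lemma is_bc_inverse_mul (R : pzRingType) (a w b c s t x y : R) :
  is_bc_inverse t c a x -> is_bc_inverse b s (x * a * w) y ->
  is_bc_inverse b c (a * w) (y * x) <-> c = c * a * w * y * x.
Proof.
move=> [_ [q xE] _ _] [[r yE] _ yb _]; split=> [[_ _ _ cE]|cE].
  by rewrite -[LHS]cE !mulrA.
split.
- by exists r; rewrite mulrA -yE.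
- by exists q; rewrite -!mulrA [x * (q * c)]mulrA -xE.
- by rewrite -[RHS]yb !mulrA.
- by rewrite [RHS]cE !mulrA.
Qed.

Theorem theorem2p7 (R : pzRingType) (a w b c s t : R)
    (ha : bc_invertible t c a)
    (haw : bc_invertible b s (bc_inverse t c a * a * w)) :
  (bc_invertible b c (a * w) /\
   bc_inverse b c (a * w) =
     bc_inverse b s (bc_inverse t c a * a * w) * bc_inverse t c a)
  <->
  c = c * a * w * bc_inverse b s (bc_inverse t c a * a * w) * bc_inverse t c a.
Proof.
have zP := is_bc_inverse_mul _ _ _ _ _ _ _ _ _
  (bc_inverseP ha) (bc_inverseP haw).
split=> [[awP zE]|/zP zinv].
  (* Invertibility of [a * w] ensures that [bc_inverse b c (a * w)] is a genuine inverse and not the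
     default 0. *)
  by apply/zP; rewrite -zE; exact: bc_inverseP.
by split; [eexists; exact: zinv | exact: bc_inverse_eq].
Qed.
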